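(* Let $f:\mathbb{R}^d\to\mathbb{R}$ be a $\mathcal{C}^2$ strongly convex function and let $\varepsilon>0$ be a constant. Let $(\mathbf{x}^*,\mathbf{p}^* )$ be the saddle point of the problem $$\inf_{\mathbf{x}\in\mathbb{R}^d}\ \sup_{\mathbf{p}\in\mathbb{R}^d}\ \langle \nabla f(\mathbf{x}),\mathbf{p}\rangle-\frac{\varepsilon}{2}\|\mathbf{p}\|^2 .$$ Then $\mathbf{x}^*$ is the unique global minimum (minimizer) of $f$.
   Context: $\langle\cdot,\cdot\rangle$ and $\|\cdot\|$ are the Euclidean inner product and norm. A saddle point of $\inf_{\mathbf{x}}\sup_{\mathbf{p}}\mathcal{L}(\mathbf{x},\mathbf{p})$ is a pair $(\mathbf{x}^*,\mathbf{p}^* )$ with $\mathcal{L}(\mathbf{x}^*,\mathbf{p})\le \mathcal{L}(\mathbf{x}^*,\mathbf{p}^* )\le\mathcal{L}(\mathbf{x},\mathbf{p}^* )$ for all $\mathbf{x},\mathbf{p}\in\mathbb{R}^d$. *)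

(* Defs.v *)
From HB Require Import structures.
From mathcomp Require Import all_boot all_order all_algebra.
From mathcomp Require Import all_classical all_reals all_analysis.

Set Implicit Arguments.
Unset Strict Implicit.
Unset Printing Implicit Defensive.

Import Order.TTheory GRing.Theory Num.Theory.
Import numFieldNormedType.Exports.

Local Open Scope classical_set_scope.
Local Open Scope ring_scope.

(* The library norm `|_| on 'rV[R]_d is the sup norm, hence these two. *)
Definition dot (R : realType) (d : nat) (u v : 'rV[R]_d) : R :=
  \sum_(i < d) u 0 i * v 0 i.

Definition enorm (R : realType) (d : nat) (u : 'rV[R]_d) : R :=
  Num.sqrt (dot u u).

Definition grad (R : realType) (d : nat) (f : 'rV[R]_d -> R) (x : 'rV[R]_d) :
    'rV[R]_d :=
  \row_(i < d) 'D_(delta_mx 0 i) f x.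

(* 'J (grad f) is the Hessian of f; the continuity of f and of its gradient
   follows from their differentiability. *)
Definition C2 (R : realType) (d : nat) (f : 'rV[R]_d -> R) : Prop :=
  [/\ forall x, differentiable f x,
      forall x, differentiable (grad f) x
    & continuous (fun x => 'J (grad f) x)].

Definition strongly_convex (R : realType) (d : nat) (f : 'rV[R]_d -> R) : Prop :=
  exists2 m : R, 0 < m &
    forall (x y : 'rV[R]_d) (t : R), 0 <= t -> t <= 1 ->
      f (t *: x + (1 - t) *: y) <=
        t * f x + (1 - t) * f y - m / 2 * t * (1 - t) * enorm (x - y) ^+ 2.

(* Saddle points for minimization in the first variable and maximization in
   the second. *)
Definition saddle_point (R : realType) (X P : Type) (L : X -> P -> R)
    (xs : X) (ps : P) : Prop :=
  forall (x : X) (p : P), L xs p <= L xs ps /\ L xs ps <= L x ps.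

Definition global_minimizer (R : realType) (X : Type) (f : X -> R) (x : X) : Prop :=
  forall y : X, f x <= f y.

(* Main.v *)
Require Import Defs.
From HB Require Import structures.
From mathcomp Require Import all_boot all_order all_algebra.
From mathcomp Require Import all_classical all_reals all_analysis.
From mathcomp Require Import ring lra.

Set Implicit Arguments.
Unset Strict Implicit.
Unset Printing Implicit Defensive.

Import Order.TTheory GRing.Theory Num.Theory.
Import numFieldNormedType.Exports.

Local Open Scope classical_set_scope.
Local Open Scope ring_scope.

(** The inner maximum in [p] is attained only where [eps *: p = grad f x], so
at the saddle point [ps] is a multiple of [g := grad f xs].  The outer minimality
then says that [x |-> dot (grad f x) g] is least at [xs].  But the gradient of
a strongly convex function is strongly monotone, so moving from [xs] in
the direction [- g] strictly decreases that quantity unless [g = 0].  Hence [xs] is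
a critical point, and the quadratic lower bound that strong convexity gives at
a critical point makes it the only minimizer.

The analytic content is [strongly_convex_first_order], the quadratic lower
bound around an arbitrary point; strong monotonicity
([strongly_monotone_grad]) is its symmetrization. *)

Section EuclideanProduct.
Variables (R : realType) (d : nat).
Implicit Types u v w : 'rV[R]_d.

Lemma dotC u v : dot u v = dot v u.
Proof. by apply: eq_bigr => i _; rewrite mulrC. Qed.

Lemma dotDl u v w : dot (u + v) w = dot u w + dot v w.
Proof. by rewrite /dot -big_split; apply: eq_bigr => i _; rewrite mxE mulrDl. Qed.

Lemma dotZl (a : R) u v : dot (a *: u) v = a * dot u v.
Proof. by rewrite /dot mulr_sumr; apply: eq_bigr => i _; rewrite mxE mulrA. Qed.

Lemma dotNl u v : dot (- u) v = - dot u v.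
Proof. by rewrite -scaleN1r dotZl mulN1r. Qed.

Lemma dotDr u v w : dot u (v + w) = dot u v + dot u w.
Proof. by rewrite !(dotC u) dotDl. Qed.

Lemma dotZr (a : R) u v : dot u (a *: v) = a * dot u v.
Proof. by rewrite !(dotC u) dotZl. Qed.

Lemma dotNr u v : dot u (- v) = - dot u v.
Proof. by rewrite !(dotC u) dotNl. Qed.

Lemma dot0l u : dot 0 u = 0.
Proof. by rewrite -(scale0r u) dotZl mul0r. Qed.

Lemma dot_ge0 u : 0 <= dot u u.
Proof. by apply: sumr_ge0 => i _; rewrite -expr2 sqr_ge0. Qed.

Lemma enorm_sqr u : enorm u ^+ 2 = dot u u.
Proof. by rewrite sqr_sqrtr // dot_ge0. Qed.

Lemma dot_le0 u : dot u u <= 0 -> u = 0.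
Proof.
move=> u_le0; have /eqP : dot u u = 0 by apply/le_anti; rewrite u_le0 dot_ge0.
rewrite psumr_eq0 => [/allP u0|i _]; last by rewrite -expr2 sqr_ge0.
apply/rowP => i; rewrite mxE; apply/eqP.
by have := u0 i; rewrite mem_index_enum mulf_eq0 orbb; apply.
Qed.

End EuclideanProduct.

Lemma derive_grad (R : realType) (d : nat) (f : 'rV[R]_d -> R) (x v : 'rV[R]_d) :
  differentiable f x -> 'D_v f x = dot (grad f x) v.
Proof.
move=> df; rewrite deriveE // {1}(row_sum_delta v) linear_sum.
by apply: eq_bigr => i _; rewrite linearZ mxE deriveE // mulrC.
Qed.

(** The body of [strongly_convex] past its quantifier on [m], so that the first-order bounds can mention
the modulus [m]. *)
Definition strongly_convex_with (R : realType) (d : nat) (m : R)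
    (f : 'rV[R]_d -> R) : Prop :=
  forall (x y : 'rV[R]_d) (t : R), 0 <= t -> t <= 1 ->
    f (t *: x + (1 - t) *: y) <=
      t * f x + (1 - t) * f y - m / 2 * t * (1 - t) * enorm (x - y) ^+ 2.

Section FirstOrder.
Variables (R : realType) (d : nat) (m : R) (f : 'rV[R]_d -> R).
Hypothesis fconv : strongly_convex_with m f.
Implicit Types x y : 'rV[R]_d.

(** Divide the convexity inequality on the segment from [x] to [y] by its
parameter [t] and let [t] decrease to [0]: the difference quotients tend to
the derivative of [f] at [x] along [y - x]. *)
Lemma strongly_convex_first_order x y : differentiable f x ->
  f x + dot (grad f x) (y - x) + m / 2 * dot (y - x) (y - x) <= f y.
Proof.
move=> df; set v := y - x; set N := dot v v.
rewrite -derive_grad //.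
pose q (t : R) := t^-1 *: (f (t *: v + x) - f x).
have qD : q t @[t --> 0^'+] --> 'D_v f x.
  apply: cvg_dnbhs_at_right; exact: (diff_derivable df).
have corr : m / 2 * N * t @[t --> (0 : R)^'+] --> m / 2 * N * 0.
  by apply: cvg_at_right_filter; apply: cvgMl_tmp; exact: cvg_id.
have lim : q t - m / 2 * N * t @[t --> 0^'+] --> ('D_v f x : R).
  by rewrite -[l in _ --> l]subr0 -[X in _ - X](mulr0 (m / 2 * N)); exact: cvgB.
suff : 'D_v f x <= f y - f x - m / 2 * N by lra.
rewrite -(cvg_lim _ lim) //; apply: limr_le; first by apply/cvg_ex; exists ('D_v f x).
near=> t.
have t0 : 0 < t by near: t; exact: nbhs_right_gt.
have t1 : t <= 1 by near: t; exact: nbhs_right_le.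
have := fconv y x (ltW t0) t1.
have -> : t *: y + (1 - t) *: x = t *: v + x.
  by rewrite /v scalerBr scalerBl scale1r addrA addrAC.
rewrite enorm_sqr -/v -/N => ht /=.
rewrite lerBlDr /q /GRing.scale /= mulrC ler_pdivrMr //.
by lra.
Unshelve. all: by end_near. Qed.

(** Add the first-order bounds at [x] and at [y]. *)
Lemma strongly_monotone_grad x y : differentiable f x -> differentiable f y ->
  m * dot (x - y) (x - y) <= dot (grad f x - grad f y) (x - y).
Proof.
move=> dx dy.
have := strongly_convex_first_order y dx; have := strongly_convex_first_order x dy.
rewrite -(opprB x y) !(dotNl, dotNr, dotDl); lra.
Qed.

End FirstOrder.

(** Comparing a maximizer [p] with the vertex [eps^-1 *: g] of the concave
quadratic and completing the square shows that the squared norm of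
[p - eps^-1 *: g], times [eps / 2], is at most [0]. *)
Lemma argmax_linear_minus_sqr (R : realType) (d : nat) (eps : R) (g p : 'rV[R]_d) :
  0 < eps ->
  (forall q, dot g q - eps / 2 * enorm q ^+ 2 <= dot g p - eps / 2 * enorm p ^+ 2) ->
  p = eps^-1 *: g.
Proof.
move=> eps_gt0 /(_ (eps^-1 *: g)); rewrite !enorm_sqr => maxp.
apply/eqP; rewrite -subr_eq0; apply/eqP/dot_le0.
rewrite -(pmulr_rle0 _ (divr_gt0 eps_gt0 (ltr0n R 2))).
move: maxp; rewrite !(dotDl, dotDr, dotNl, dotNr, dotZl, dotZr) (dotC p g).
set a := dot g g; set b := dot g p; set c := dot p p => maxp.
have e0 : eps != 0 by rewrite gt_eqF.
have -> : eps / 2 * (c - eps^-1 * b + (- (eps^-1 * b) - - (eps^-1 * (eps^-1 * a))))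
  = (eps^-1 * a - eps / 2 * (eps^-1 * (eps^-1 * a))) - (b - eps / 2 * c) by field.
by rewrite subr_le0.
Qed.

Theorem proposition2p2 (R : realType) (d : nat) (f : 'rV[R]_d -> R) (eps : R)
    (hC2 : C2 f) (hconv : strongly_convex f) (heps : 0 < eps)
    (xs ps : 'rV[R]_d)
    (hsaddle : saddle_point
       (fun x p : 'rV[R]_d => dot (grad f x) p - eps / 2 * enorm p ^+ 2) xs ps) :
  global_minimizer f xs /\
  (forall y : 'rV[R]_d, global_minimizer f y -> y = xs).
Proof.
have [df _ _] := hC2; have [m m_gt0 fconv] := hconv.
set g := grad f xs.
have ps_g : ps = eps^-1 *: g.
  by apply: argmax_linear_minus_sqr => // q; have [] := hsaddle xs q.
have g0 : g = 0.
  (* A unit step along [- g]: strong monotonicity bounds the change of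
     [dot (grad f x) g] for steps of any length. *)
  apply: dot_le0; have [_] := hsaddle (xs - g) ps.
  rewrite lerD2r ps_g !dotZr ler_pM2l ?invr_gt0 // -/g => min_g.
  have := strongly_monotone_grad fconv (df xs) (df (xs - g)).
  rewrite opprB addrC subrK -/g dotDl dotNl => mono.
  by rewrite -(pmulr_rle0 _ m_gt0); lra.
have quad y : f xs + m / 2 * dot (y - xs) (y - xs) <= f y.
  have := strongly_convex_first_order fconv y (df xs).
  by rewrite -/g g0 dot0l addr0.
have m2_gt0 : 0 < m / 2 by rewrite divr_gt0.
split=> y.
  by apply: le_trans (quad y); rewrite lerDl mulr_ge0 ?dot_ge0 // ltW.
move=> /(_ xs) fy; apply/eqP; rewrite -subr_eq0; apply/eqP/dot_le0.
by rewrite -(pmulr_rle0 _ m2_gt0); have := quad y; lra.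
Qed.
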